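(* There is a constant $c\in\mathbb{N}$ such that the following holds. Let $r$ be a positive integer, $k\ge2$ an integer, and $G$ an $n$-vertex graph with $n\ge2$ whose distance-$r$ balanced separator number is at most $k$. Then $G$ has a tree decomposition whose every bag is $(ck^2\log k,\ r(\log k+\log\log n+c))$-coverable.
   Context: Graphs are finite, simple, unweighted, with shortest-path distance $\mathrm{dist}_G$; logarithms are base 2. A vertex set $A$ is $(k,\rho)$-coverable if there are $k$ balls $\mathrm{Ball}_G(u,\rho)=\{v:\mathrm{dist}_G(u,v)\le \rho\}$ in $G$ whose union contains $A$. For $\mu:V(G)\to\mathbb{R}_{\ge0}$, $X\subseteq V(G)$ is a balanced separator for $\mu$ if every connected component $C$ of $G-X$ has $\mu(V(C))\le\frac12\mu(V(G))$. The distance-$r$ balanced separator number of $G$ is the smallest $k$ such that every weight function $\mu:V(G)\to\mathbb{R}_{\ge0}$ admits a $(k,r)$-coverable balanced separator. *)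

(* Defs.v *)
From mathcomp Require Import all_boot all_order all_algebra.
From mathcomp Require Import boolp classical_sets reals constructive_ereal ereal exp.
Set Implicit Arguments.
Unset Strict Implicit.
Unset Printing Implicit Defensive.

Import Order.TTheory GRing.Theory Num.Theory.
Local Open Scope ring_scope.

Record sgraph := SGraph {
  vertex :> finType;
  edge : rel vertex;
  edge_sym : symmetric edge;
  edge_irrefl : irreflexive edge }.

(* A walk from u is a sequence p with path (edge G) u p; it ends at last u p
   and has size p edges.  The infimum is +oo when v is not reachable from u. *)
Definition dist (R : realType) (G : sgraph) (u v : G) : \bar R :=
  ereal_inf [set (size p)%:R%:E | p in
    [set p : seq G | path (@edge G) u p /\ last u p = v]]%classic.

Definition gball (R : realType) (G : sgraph) (u : G) (rho : R) : {set G} :=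
  [set v | (dist R u v <= rho%:E)%E]%SET.

(* Both parameters are real: for real k, "k balls" means at most k balls. *)
Definition coverable (R : realType) (G : sgraph) (k rho : R) (A : {set G}) :
    Prop :=
  exists2 S : {set G}, #|S|%:R <= k & A \subset (\bigcup_(u in S) gball u rho)%SET.

Definition induced_edge (G : sgraph) (A : {set G}) : rel G :=
  [rel u v | [&& u \in A, v \in A & edge u v]].

(* The vertex sets of the connected components of G - X. *)
Definition components_del (G : sgraph) (X : {set G}) : {set {set G}} :=
  equivalence_partition (connect (induced_edge (~: X)%SET)) (~: X)%SET.

Definition balanced_separator (R : realType) (G : sgraph) (mu : G -> R)
    (X : {set G}) : Prop :=
  forall C : {set G}, C \in components_del X ->
    \sum_(v in C) mu v <= 2^-1 * \sum_(v : G) mu v.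

Definition separable (R : realType) (G : sgraph) (r k : nat) : Prop :=
  forall mu : G -> R, (forall v, 0 <= mu v) ->
    exists2 X : {set G}, coverable (k%:R : R) r%:R X & balanced_separator mu X.

Lemma ex_separable (R : realType) (G : sgraph) (r : nat) :
  exists k : nat, `[< separable R G r k >].
Proof.
exists #|G|; apply/asboolP => mu _; exists [set: G]%SET.
  exists [set: G]%SET; first by rewrite cardsT lexx.
  apply/fintype.subsetP => v _; apply/finset.bigcupP; exists v; rewrite ?inE //.
  apply: ge_ereal_inf; exists 0%E; last by rewrite lee_fin.
  by exists [::].
by move=> C /imsetP[x]; rewrite !inE.
Qed.

Definition separator_number (R : realType) (G : sgraph) (r : nat) : nat :=
  ex_minn (ex_separable R G r).

Definition is_tree (T : sgraph) : Prop :=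
  [/\ (0 < #|T|)%N,
      forall s t : T, connect (@edge T) s t
    & forall c : seq T, (2 < size c)%N -> ~~ (cycle (@edge T) c && uniq c)].

Definition tree_decomposition (G T : sgraph) (B : T -> {set G}) : Prop :=
  [/\ is_tree T,
      forall v : G, exists t : T, v \in B t,
      forall u v : G, edge u v -> exists t : T, (u \in B t) && (v \in B t)
    & forall (v : G) (s t : T), v \in B s -> v \in B t ->
        connect (induced_edge [set x : T | v \in B x]%SET) s t].

Definition log2 (R : realType) (x : R) : R := ln x / ln 2.

(* Main.v *)
Require Import Defs.
From mathcomp Require Import all_boot all_order all_algebra.
From mathcomp Require Import boolp classical_sets reals constructive_ereal ereal exp.
From mathcomp Require Import fintype finset zify.
Set Implicit Arguments.
Unset Strict Implicit.
Unset Printing Implicit Defensive.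

Import Order.TTheory GRing.Theory Num.Theory.

Local Open Scope nat_scope.

(** Start from C = V(G). Take a separator X, use nbhd C together with C meet X as a bag, and recurse
    into C meet D for each component D of G - X ([exists_decomposes], [decomposes_glue]). Joining a
    separator that halves C with one that halves the current set S of ball centres
    ([separable_set2]) gives an X covered by m = 2k balls of radius r. As C halves, the recursion
    depth d is at most log n.

    The difficulty is to keep nbhd C covered by O(k^2) balls of small radius a(u) r. On passing to
    D, the centres inside D are kept, at most half of S. A ball centred outside D enters D only
    through X, hence close to some new centre x, so an enlarged ball at x could replace it. Doing
    this every time could enlarge radii at every level, giving order r log n. Instead the potential,
    the sum of 2^a(u), is allowed to grow by only 2m per level ([absorb], [covers_component]): if
    many outer balls reach almost farthest past x, their potential pays for the enlarged ball at x;
    if few do, those few are kept and cover whatever the other outer balls cover past x.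

    The number of centres thus stays below 64m^2 + 2m, and the potential at depth d is at most 2md
    <= 4k log n, so every a(u) is at most log k + log log n + 2. *)

(** * Exchanging balls under an exponential potential *)

(** In use, A holds the old centres outside D, Y the new centres, and [e x u] measures how far the
    ball at u reaches past x. Each pair x, u is settled either by the new level [b x] or by a kept
    centre w in K reaching three units farther past x. *)
Lemma absorb (T : finType) (A Y : {set T}) (a : T -> nat) (e : T -> T -> nat)
    (m : nat) :
  0 < m -> #|Y| <= m -> (forall x u, e x u <= (a u).+1) ->
  exists (K : {set T}) (b : T -> nat),
    [/\ K \subset A, #|K| <= 32 * m * #|Y|,
        \sum_(x in Y) 2 ^ b x <= 2 * #|Y| + \sum_(u in A :\: K) 2 ^ a u,
        forall x, x \in Y -> 0 < b x
      & forall x u, x \in Y -> u \in A :\: K ->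
          e x u + 2 <= b x \/ exists2 w, w \in K & e x u + 3 <= e x w].
Proof.
move=> m_gt0 leYm le_e.
(* Z collects the new centres that are served by kept balls alone, at a price of 32m kept balls
   each; a maximal such Z is chosen. *)
pose good (Z K : {set T}) := [/\ K \subset A, #|K| <= 32 * m * #|Z|
  & forall x u, x \in Z -> u \in A :\: K -> exists2 w, w \in K & e x u + 3 <= e x w].
pose P (Z : {set T}) := (Z \subset Y) && `[< exists K, good Z K >].
have P0 : P set0.
  rewrite /P sub0set; apply/asboolP; exists set0; split; rewrite ?sub0set ?cards0 //.
  by move=> x u; rewrite inE.
have [Z maxZ _] := maxset_exists P0.
have [/andP[ZY /asboolP[K [KA cardK ZK]]] maxZP] := maxsetP maxZ.
                                                                                
                                                                                   
pose E x := \max_(u in A :\: K) e x u.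
pose Q x := [set u in A :\: K | E x <= e x u + 2].
(* If fewer than 32m balls came within 2 of the maximum [E x], keeping them all would let x join Z,
   against maximality. *)
have largeQ x : x \in Y :\: Z -> 32 * m <= #|Q x|.
  rewrite inE => /andP[xZ xY]; rewrite leqNgt; apply/negP => smallQ.
  have PxZ : P (x |: Z).
    rewrite /P subUset sub1set xY ZY /=; apply/asboolP; exists (K :|: Q x); split.
    - rewrite subUset KA /=; apply/subsetP => u; rewrite !inE.
      by case/andP=> /andP[].
    - rewrite cardsU1 xZ /= mulnDr muln1.
      by apply: leq_trans (leq_card_setU _ _) _; rewrite addnC leq_add // ltnW.
    - move=> y u /setU1P[->|yZ].
        rewrite !inE !negb_or => /andP[/andP[uK uQ] uA].
        have uAK : u \in A :\: K by rewrite inE uK.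
        have [|w wAK Ew] := @eq_bigmax_cond _ (mem (A :\: K)) (e x).
          by apply/card_gt0P; exists u.
        exists w; last first.
          move: uQ; rewrite uK uA /= -ltnNge -/(E x) => uQ.
          by rewrite -Ew -/(E x); lia.
        by rewrite !inE; move: wAK; rewrite inE => /andP[-> ->]; rewrite /E Ew leq_addr orbT.
      rewrite setDUr inE => /andP[uAK _].
      by have [w wK Hw] := ZK y u yZ uAK; exists w => //; rewrite inE wK.
  by have := maxZP _ PxZ (subsetUr _ _) => /setP/(_ x); rewrite setU11 (negPf xZ).
pose b x := if x \in Z then 1 else (E x).+2.
exists K, b; split => //.
- by apply: leq_trans cardK _; rewrite leq_mul2l subset_leq_card ?orbT.
- rewrite (big_setID Z) /=; apply: leq_add.
    rewrite (setIidPr ZY) (eq_bigr (fun=> 2)) => [|x xZ]; last by rewrite /b xZ.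
    by rewrite sum_nat_const mulnC leq_mul2l subset_leq_card ?orbT.
  (* All of Y draws on the same potential of A minus K, so each of its at most m points may claim a
     1/m share. *)
  rewrite -(leq_pmul2l m_gt0) big_distrr /=.
  apply: (@leq_trans (\sum_(x in Y :\: Z) \sum_(u in A :\: K) 2 ^ a u)); last first.
    by rewrite sum_nat_const leq_mul2r (leq_trans (subset_leq_card (subsetDl _ _))) ?orbT.
  apply: leq_sum => x xYZ.
  have xZ : x \notin Z by move: xYZ; rewrite inE => /andP[].
  rewrite /b (negPf xZ).
  apply: (@leq_trans (\sum_(u in Q x) 2 ^ a u)); last first.
    rewrite [X in _ <= X](big_setID (Q x)) /=.
    have -> : (A :\: K) :&: Q x = Q x by apply/setIidPr/subsetP => u; rewrite inE => /andP[].
    by rewrite leq_addr.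
  (* Here 8 m 2^(E+2) = 32 m 2^E, while membership in [Q x] and [le_e] give E <= a(u) + 3. *)
  rewrite -(@leq_pmul2l 8) //.
  apply: (@leq_trans (\sum_(u in Q x) 2 ^ E x)).
    rewrite sum_nat_const !expnS.
    by have := largeQ x xYZ => /(leq_mul (leqnn (2 ^ E x))); lia.
  rewrite big_distrr /=; apply: leq_sum => u; rewrite inE => /andP[_ uQ].
  have -> : 8 * 2 ^ a u = 2 ^ (a u).+3 by rewrite !expnS; lia.
  by rewrite leq_pexp2l //; have := le_e x u; lia.
- by move=> x _; rewrite /b; case: ifP.
- move=> x u xY uAK; have [xZ|xZ] := boolP (x \in Z); first by right; apply: ZK.
  left; rewrite /b (negPf xZ) addn2 !ltnS.
  exact: (@leq_bigmax_cond _ (mem (A :\: K)) (e x)).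
Qed.

(** * Walks, components and neighbourhoods *)

(** Distance at most d, kept in the naturals; [gball_walk] and [walk_gball] translate from and to
    balls. *)
Definition walk (G : sgraph) (d : nat) (u v : G) : Prop :=
  exists2 p : seq G, path (@edge G) u p /\ last u p = v & size p <= d.

Lemma walk_le (G : sgraph) (d d' : nat) (u v : G) :
  d <= d' -> walk d u v -> walk d' u v.
Proof. by move=> le_d [p pP sp]; exists p => //; exact: leq_trans sp le_d. Qed.

Lemma walk_trans (G : sgraph) (d d' : nat) (u v w : G) :
  walk d u v -> walk d' v w -> walk (d + d') u w.
Proof.
move=> [p [pp <-] sp] [q [qp <-] sq]; exists (p ++ q).
  by rewrite cat_path pp last_cat.
by rewrite size_cat leq_add.
Qed.

Lemma walk_sym (G : sgraph) (d : nat) (u v : G) : walk d u v -> walk d v u.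
Proof.
move=> [p [pp <-] sp]; exists (rev (belast u p)); last by rewrite size_rev size_belast.
split; last by case: p {pp sp} => //= w p; rewrite rev_cons last_rcons.
by rewrite rev_path (eq_path (e' := @edge G)) // => x y; exact: edge_sym.
Qed.

Definition nbhd (G : sgraph) (C : {set G}) : {set G} :=
  [set v | (v \notin C) && [exists u in C, edge u v]].

Lemma components_del_disjoint (G : sgraph) (X D : {set G}) :
  D \in components_del X -> [disjoint D & X].
Proof.
case/imsetP=> x _ ->; apply/pred0P => y /=; rewrite !inE.
by case: (y \in X); rewrite /= ?andbF.
Qed.

Lemma induced_connect_sym (G : sgraph) (A : {set G}) :
  connect_sym (induced_edge A).
Proof.
by apply: sym_connect_sym => x y; rewrite /induced_edge /= edge_sym andbCA.
Qed.

Lemma components_del_edge (G : sgraph) (X D : {set G}) (u v : G) :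
  D \in components_del X -> u \in D -> v \notin X -> edge u v -> v \in D.
Proof.
case/imsetP=> x _ ->; rewrite !inE => /andP[uX cxu] vX uv; rewrite vX /=.
by apply: connect_trans cxu (connect1 _); rewrite /induced_edge /= !inE uX vX.
Qed.

Lemma components_del_inj (G : sgraph) (X D D' : {set G}) (v : G) :
  D \in components_del X -> D' \in components_del X ->
  v \in D -> v \in D' -> D = D'.
Proof.
case/imsetP=> x _ -> /imsetP[x' _ ->]; rewrite !inE => /andP[_ cxv] /andP[_ cxv'].
apply/setP => y; rewrite !inE; congr (_ && _).
rewrite (same_connect (@induced_connect_sym G (~: X)) cxv).
by rewrite (same_connect (@induced_connect_sym G (~: X)) cxv').
Qed.

Lemma components_del_cover (G : sgraph) (X : {set G}) (v : G) :
  v \notin X -> exists2 D, D \in components_del X & v \in D.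
Proof.
move=> vX.
exists [set y in ~: X | connect (induced_edge (~: X)) v y].
  by apply: imset_f; rewrite inE.
by rewrite !inE vX connect0.
Qed.

Lemma components_del_mono (G : sgraph) (X X' D : {set G}) :
  X \subset X' -> D \in components_del X' ->
  exists2 D', D' \in components_del X & D \subset D'.
Proof.
move=> XX' /imsetP[x]; rewrite inE => xX' ->.
have sub y : y \notin X' -> y \notin X by apply: contra; apply: (subsetP XX').
exists [set y in ~: X | connect (induced_edge (~: X)) x y].
  by apply: imset_f; rewrite inE sub.
apply/subsetP => y; rewrite !inE => /andP[/sub-> /=].
apply: connect_sub => u v; rewrite /induced_edge /= !inE => /and3P[uX vX uv].
by apply: connect1; rewrite /= !inE !sub.
Qed.

(** No edge enters D from a vertex outside both X and D, so the walk meets X before D; y is its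
    first vertex in X. *)
Lemma walk_cross (G : sgraph) (X D : {set G}) (d : nat) (u v : G) :
  D \in components_del X -> u \notin D -> v \in D -> walk d u v ->
  exists y d1 d2, [/\ y \in X, d1 + d2 <= d, walk d1 u y & walk d2 y v].
Proof.
move=> DX uD vD [p [pp lp] sp]; elim: p u d uD pp lp sp => [|w p IH] u d uD /=.
  by move=> _ uv; move: uD; rewrite uv vD.
case/andP=> uw pp lp sp.
have [uX|uX] := boolP (u \in X).
  by exists u, 0, d; split => //; [exists [::] | exists (w :: p); rewrite /= ?uw].
have wD : w \notin D.
  by apply: contra uD => wD; apply: (components_del_edge DX wD uX); rewrite edge_sym.
have [|y [d1 [d2 [yX le_d w1 w2]]]] := IH w d.-1 wD pp lp; first by lia.
exists y, d1.+1, d2; split => //; first by lia.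
rewrite -add1n; apply: walk_trans w1; by exists [:: w]; rewrite /= ?uw.
Qed.

(** * Passing a cover on to a component *)

Definition covers (G : sgraph) (r : nat) (S : {set G}) (a : G -> nat)
    (W : {set G}) : Prop :=
  forall v, v \in W -> exists2 u, u \in S & walk (a u * r) u v.

(** A neighbour of C meet D that avoids X stays in D, so it is outside C and belongs to nbhd C. *)
Lemma nbhd_component (G : sgraph) (X C D : {set G}) :
  D \in components_del X -> nbhd (C :&: D) \subset (nbhd C :&: D) :|: (X :&: (C :|: nbhd C)).
Proof.
move=> DX; apply/subsetP => w; rewrite inE => /andP[wCD /existsP[u /andP[]]].
rewrite inE => /andP[uC uD] uw.
have wCN : w \in C :|: nbhd C.
  rewrite !inE; case: (w \in C) => //=; apply/existsP; exists u; exact/andP.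
have [wX|wX] := boolP (w \in X); first by rewrite inE [w \in _ :&: (_ :|: _)]inE wX wCN orbT.
have wD := components_del_edge DX uD wX uw.
move: wCN wCD; rewrite in_setU [w \in C :&: D]inE wD andbT => wCN wC.
by rewrite inE [w \in nbhd C :&: D]inE wD andbT; move: wCN; rewrite (negPf wC) /= => ->.
Qed.

(** The new centres are those of S in D, the kept set K of [absorb], and Y. Only the centres in D
    count at full price, so halving S keeps the total bounded. *)
Lemma covers_component (G : sgraph) (r m : nat) (S Y W X D : {set G})
    (a : G -> nat) :
  0 < r -> 0 < m -> #|Y| <= m -> D \in components_del X ->
  covers r S a W -> covers r Y (fun=> 1) X ->
  exists (S' : {set G}) (a' : G -> nat),
    [/\ covers r S' a' ((W :&: D) :|: X),
        #|S'| <= #|S :&: D| + 32 * m * m + m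
      & \sum_(u in S') 2 ^ a' u <= \sum_(u in S) 2 ^ a u + 2 * m].
Proof.
move=> r_gt0 m_gt0 leYm DX covW covX.
                                                                             
                                              
(* The reach of the ball at u past x in units of r, with one extra unit granted for the hop between
   x and X. The value is 0 also when no j qualifies, whence the positivity assumption in
   [e_walk]. *)
pose e x u := \max_(j < (a u).+2 | `[< walk (((a u).+1 - j) * r) u x >]) (j : nat).
have le_e x u : e x u <= (a u).+1.
  by apply/bigmax_leqP => j _; rewrite -ltnS.
have e_walk x u : 0 < e x u -> walk (((a u).+1 - e x u) * r) u x.
  move=> e_gt0.
  pose P := [pred j : 'I_(a u).+2 | `[< walk (((a u).+1 - j) * r) u x >]].
  have [|j Pj Ej] := @eq_bigmax_cond _ P (fun j => j : nat).
    case: (pickP P) => [j Pj|no_j]; first by apply/card_gt0P; exists j.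
    by move: e_gt0; rewrite /e big_pred0.
  by rewrite /e Ej; apply/asboolP.
have e_max x u j : j <= (a u).+1 -> walk (((a u).+1 - j) * r) u x -> j <= e x u.
  move=> le_j wj; have jlt : j < (a u).+2 by [].
  by apply: (@leq_bigmax_cond _ _ _ (Ordinal jlt)); apply/asboolP.
(* Of the two added units, one pays for the hop from x to y and one for rounding d2 / r up. *)
have e_cross x u y v d1 d2 : d1 + d2 <= a u * r -> walk d1 u y -> walk d2 y v ->
    walk (1 * r) x y -> walk ((e x u + 2) * r) x v.
  move=> le_d w1 w2 wxy.
  have le_j : d2 %/ r <= a u.
    by rewrite -(leq_pmul2r r_gt0); apply: leq_trans (leq_trunc_div _ _) _; lia.
  have : d2 %/ r <= e x u.
    apply: e_max; first by lia.
    apply: walk_le (walk_trans w1 (walk_sym wxy)).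
    by have := leq_trunc_div d2 r; nia.
  move=> le_je; apply: walk_le (walk_trans wxy w2).
  have := ltn_ceil d2 r_gt0; nia.
have [K [b [KA cardK sumb b_gt0 covK]]] := absorb (S :\: D) m_gt0 leYm le_e.
pose S0 := (S :&: D) :|: K.
(* A centre in both families takes the larger level; its potential is at most the sum of the two. *)
pose a' w := maxn (if w \in S0 then a w else 0) (if w \in Y then b w else 0).
have a'S w : w \in S0 -> a w <= a' w by move=> wS; rewrite /a' wS leq_maxl.
have a'Y w : w \in Y -> b w <= a' w by move=> wY; rewrite /a' wY leq_maxr.
exists (S0 :|: Y), a'; split.
- move=> v /setUP[/setIP[vW vD]|vX]; last first.
    have [x xY wxv] := covX v vX; exists x; first by rewrite inE xY orbT.
    by apply: walk_le wxv; rewrite leq_mul2r (leq_trans (b_gt0 x xY)) ?orbT ?a'Y.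
  have [u uS wuv] := covW v vW.
  have keep w : w \in S0 -> walk (a w * r) w v ->
      exists2 u, u \in S0 :|: Y & walk (a' u * r) u v.
    move=> wS wwv; exists w; first by rewrite inE wS.
    by apply: walk_le wwv; rewrite leq_mul2r a'S ?orbT.
  have [uD|uD] := boolP (u \in D); first by apply: keep wuv; rewrite !inE uS uD.
  have [uK|uK] := boolP (u \in K); first by apply: keep wuv; rewrite !inE uK orbT.
  have [y [d1 [d2 [yX le_d w1 w2]]]] := walk_cross DX uD vD wuv.
  have [x xY wxy] := covX y yX.
  have wxv := e_cross x u y v d1 d2 le_d w1 w2 wxy.
  have [|le_eb|[w wK le_ee]] := covK x u xY; first by rewrite !inE uK uD.
    exists x; first by rewrite inE xY orbT.
    by apply: walk_le wxv; rewrite leq_mul2r (leq_trans le_eb) ?orbT ?a'Y.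
  apply: (keep w); first by rewrite !inE wK orbT.
  (* Going from w to x and on to v costs (a(w) + 1 - e x w) + (e x u + 2) units, at most a(w) by the
     gap of three. *)
  apply: walk_le (walk_trans (e_walk x w _) wxv); last by lia.
  by rewrite -mulnDl leq_mul2r; have := le_e x w; lia.
- apply: leq_trans (leq_card_setU _ _) _; apply: leq_add => //.
  apply: leq_trans (leq_card_setU _ _) _; rewrite leq_add2l.
  by apply: leq_trans cardK _; rewrite leq_mul2l leYm orbT.
- apply: (@leq_trans (\sum_(u in S0) 2 ^ a u + \sum_(u in Y) 2 ^ b u)).
    rewrite [X in X <= _]big_mkcond [X in _ <= X + _]big_mkcond.
    rewrite [X in _ <= _ + X]big_mkcond -big_split /=; apply: leq_sum => u _.
    rewrite /a' inE; case: (u \in S0); case: (u \in Y) => //=;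
      rewrite ?max0n ?maxn0 ?addn0 //.
    by case: (leqP (a u) (b u)) => _; rewrite ?leq_addl ?leq_addr.
  rewrite [\sum_(u in S) _](big_setID D) [\sum_(u in S :\: D) _](big_setID K) /=.
  rewrite (setIidPr KA) /S0.
  have dSK : [disjoint S :&: D & K].
    apply/pred0P => u /=; rewrite !inE; apply/negP => /andP[/andP[_ uD] uK].
    by have := subsetP KA u uK; rewrite inE uD.
  have -> : \sum_(u in S :&: D :|: K) 2 ^ a u =
      \sum_(u in S :&: D) 2 ^ a u + \sum_(u in K) 2 ^ a u.
    by rewrite -bigU //; apply: eq_bigl => u; rewrite in_setU.
  rewrite -!addnA leq_add2l leq_add2l.
  by apply: leq_trans sumb _; rewrite addnC leq_add2l leq_mul2l leYm orbT.
Qed.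

(** * Recursive construction of rooted decompositions *)

Record rooted_bags (G : sgraph) := RootedBags {
  node : finType;
  root : node;
  parent : node -> node;
  depth : node -> nat;
  bag : node -> {set G} }.

                                                                          
(** [decomposes_top] encodes connectivity: nodes containing v climb to a common top without losing
    v. [decomposes_root] makes gluing below a new root possible. The case u = v in [decomposes_edge]
    covers single vertices. *)
Record decomposes (G : sgraph) (good : {set G} -> Prop) (C : {set G})
    (D : rooted_bags G) : Prop := Decomposes {
  decomposes_parent_root : parent (root D) = root D;
  decomposes_depth :
    forall t : node D, t != root D -> depth (parent t) < depth t;
  decomposes_good : forall t : node D, good (bag t);
  decomposes_sub : forall t : node D, bag t \subset C :|: nbhd C;
  decomposes_root : nbhd C \subset bag (root D);
  decomposes_edge : forall u v : G, u \in C -> (u == v) || edge u v ->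
    exists t : node D, (u \in bag t) && (v \in bag t);
  decomposes_top : forall v : G, exists t0 : node D, forall t : node D,
    v \in bag t -> t != t0 -> (t != root D) && (v \in bag (parent t)) }.

Definition glue_parent (G : sgraph) (I : finType) (f : I -> rooted_bags G)
    (t : option {i : I & node (f i)}) : option {i : I & node (f i)} :=
  if t is Some (existT i s) then
    if s == root (f i) then None
    else Some (existT (fun i => node (f i)) i (parent s))
  else None.

Definition glue (G : sgraph) (I : finType) (f : I -> rooted_bags G)
    (W : {set G}) : rooted_bags G :=
  @RootedBags G (option {i : I & node (f i)}) None (@glue_parent G I f)
    (fun t => if t is Some (existT i s) then (depth s).+1 else 0)
    (fun t => if t is Some (existT i s) then bag s else W).

(** The new root bag W contains the neighbourhood of every piece. Hence a vertex outside W occurs in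
    at most one subtree, and a vertex of W occurring in a subtree occurs in that subtree's root
    bag. *)
Lemma decomposes_glue (G : sgraph) (good : {set G} -> Prop) (C X : {set G})
    (f : {D : {set G} | D \in components_del X} -> rooted_bags G) :
  good (nbhd C :|: (C :&: X)) ->
  (forall D, decomposes good (C :&: val D) (f D)) ->
  decomposes good C (glue f (nbhd C :|: (C :&: X))).
Proof.
move=> goodW decf; set W := _ :|: _ in goodW *.
pose I := {D : {set G} | D \in components_del X}.
have nbhdW (i : I) : nbhd (C :&: val i) \subset W.
  apply: subset_trans (nbhd_component C (valP i)) _; apply/subsetP => w.
  by rewrite !inE => /orP[/andP[-> //]|/andP[-> /orP[->|->]]]; rewrite ?orbT.
have WCN : W \subset C :|: nbhd C.
  by rewrite subUset subsetUr (subset_trans (subsetIl _ _)) // subsetUl.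
have subW (i : I) (t : node (f i)) v : v \in bag t -> v \notin W -> v \in C :&: val i.
  move=> vt; apply: contraR => vC.
  have := subsetP (decomposes_sub (decf i) t) v vt.
  by rewrite inE (negPf vC) => /(subsetP (nbhdW i)).
have outW (i : I) v : v \in W -> v \notin C :&: val i.
  move=> vW; apply/negP; rewrite inE => /andP[vC vi].
  have := components_del_disjoint (valP i) => /pred0P/(_ v)/=; rewrite vi /= => vX.
  by move: vW; rewrite !inE vC vX.
have coverC v : v \in C -> v \notin X -> exists i : I, v \in C :&: val i.
  move=> vC vX; have [D DX vD] := components_del_cover vX.
  by exists (exist _ D DX : I); rewrite inE vC.
split => //.
- case=> [[i t]|] //= _; case: eqVneq => [//|tr] /=.
  by rewrite ltnS; exact: (decomposes_depth (decf i)).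
- by case=> [[i t]|] //=; exact: (decomposes_good (decf i)).
- case=> [[i t]|] //=; apply/subsetP => v vt.
  have [/(subsetP WCN)//|vW] := boolP (v \in W).
  by have := subW _ _ _ vt vW; rewrite !inE => /andP[->].
- exact: subsetUl.
- move=> u v uC uv.
  have child (i : I) : u \in C :&: val i -> exists t : node (glue f W), (u \in bag t) && (v \in bag t).
    move=> ui; have [t ht] := decomposes_edge (decf i) ui uv.
    by exists (Some (existT (fun i => node (f i)) i t)).
  have [uX|uX] := boolP (u \in X); last first.
    by have [i ui] := coverC u uC uX; exact: child ui.
  have uW : u \in W by rewrite inE [u \in C :&: X]inE uC uX orbT.
  have [vW|vW] := boolP (v \in W); first by exists None; rewrite /= uW vW.
  have uv' : edge u v by case/orP: uv => // /eqP uv; rewrite uv (negPf vW) in uW.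
  have vC : v \in C.
    apply: contraR vW => vC; rewrite !inE vC /=; apply/orP; left.
    by apply/existsP; exists u; rewrite uC.
  have vX : v \notin X by apply: contra vW => vX; rewrite inE [v \in C :&: X]inE vC vX orbT.
  have [i vi] := coverC v vC vX.
  have [|t ht] := decomposes_edge (decf i) vi (v := u); first by rewrite edge_sym uv' orbT.
  by exists (Some (existT (fun i => node (f i)) i t)); rewrite andbC.
- move=> v; have [vW|vW] := boolP (v \in W).
    exists None; case=> [[i t]|] //= vt _; case: eqVneq => [//|tr] /=.
    have [t0 top0] := decomposes_top (decf i) v.
    have vr : v \in bag (root (f i)).
      apply: (subsetP (decomposes_root (decf i))).
      have := subsetP (decomposes_sub (decf i) t) v vt.
      by rewrite inE (negPf (outW i v vW)).
    (* As v lies in the root bag, its top node there must be the root. *)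
    have t0r : t0 = root (f i).
      by apply/eqP; apply: contraT; rewrite eq_sym => /(top0 _ vr); rewrite eqxx.
    by have := top0 t vt; rewrite t0r => /(_ tr)/andP[].
  have [/existsP[i vi]|noi] := boolP [exists i : I, v \in C :&: val i]; last first.
    exists None; case=> [[j t]|] /= vt; last by rewrite (negPf vW) in vt.
    by case/negP: noi; apply/existsP; exists j; exact: subW vt vW.
  have [t0 top0] := decomposes_top (decf i) v.
  exists (Some (existT (fun i => node (f i)) i t0)).
  case=> [[j t]|] /= vt; last by rewrite (negPf vW) in vt.
  have ij : i = j.
    have vj := subW _ _ _ vt vW; apply: val_inj.
    move: vi vj; rewrite !inE => /andP[_ vi] /andP[_ vj].
    exact: (components_del_inj (valP i) (valP j) vi vj).
  case: j / ij t vt => t vt tt0.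
  have /andP[tr vp] : (t != root (f i)) && (v \in bag (parent t)).
    by apply: top0 => //; apply: contra tt0 => /eqP->.
  by rewrite (negPf tr).
Qed.

Lemma exists_decomposes (G : sgraph) (good inv : {set G} -> Prop) :
  good set0 ->
  (forall C, inv C -> C != set0 -> exists X : {set G},
    good (nbhd C :|: (C :&: X)) /\ forall D, D \in components_del X ->
      inv (C :&: D) /\ #|C :&: D| < #|C|) ->
  forall C, inv C -> exists D, decomposes good C D.
Proof.
move=> good0 step C; have [n] := ubnP #|C|; elim: n C => // n IH C ltC invC.
have [->|C0] := eqVneq C set0.
  exists (@RootedBags G unit tt id (fun=> 0) (fun=> set0)).
  split=> //=.
  - by move=> _; exact: sub0set.
  - by apply/subsetP => v; rewrite !inE => /existsP[u]; rewrite inE.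
  - by move=> u v; rewrite inE.
have [X [goodX subX]] := step C invC C0.
have /choice[f decf] : forall D : {D : {set G} | D \in components_del X},
    exists R, decomposes good (C :&: val D) R.
  move=> D; have [invD ltD] := subX _ (valP D).
  by apply: IH => //; lia.
by exists (glue f (nbhd C :|: (C :&: X))); exact: decomposes_glue.
Qed.

(** * From parent maps to tree decompositions *)

Definition tree_edge (T : finType) (p : T -> T) : rel T :=
  [rel s t | (s != t) && ((p s == t) || (p t == s))].

Lemma tree_edge_sym (T : finType) (p : T -> T) : symmetric (tree_edge p).
Proof. by move=> s t; rewrite /tree_edge /= eq_sym orbC. Qed.

Lemma tree_edge_irrefl (T : finType) (p : T -> T) : irreflexive (tree_edge p).
Proof. by move=> s; rewrite /tree_edge /= eqxx. Qed.

Definition parent_graph (T : finType) (p : T -> T) : sgraph :=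
  SGraph (@tree_edge_sym T p) (@tree_edge_irrefl T p).

Lemma parent_graph_tree (T : finType) (p : T -> T) (h : T -> nat) (r : T) :
  p r = r -> (forall t, t != r -> h (p t) < h t) -> is_tree (parent_graph p).
Proof.
move=> pr hp; split.
- by apply/card_gt0P; exists r.
- have to_r (t : T) : connect (tree_edge p) t r.
    have [n] := ubnP (h t); elim: n t => // n IH t ltn_t.
    have [->|tr] := eqVneq t r; first exact: connect0.
    have lt_p := hp t tr.
    apply: connect_trans (connect1 _) (IH (p t) _); last by lia.
    rewrite /tree_edge /= eqxx andbT; apply/eqP => tp; by rewrite -tp ltnn in lt_p.
  move=> s t; apply: connect_trans (to_r s) _.
  by rewrite (sym_connect_sym (@tree_edge_sym T p)).
- move=> c c2; apply/negP => /andP[cyc uc].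
  have [t0 t0c] : exists t, t \in c by case: c c2 {cyc uc} => // t c _; exists t; rewrite inE eqxx.
  have [t tc maxt] := arg_maxnP h t0c.
                                                                          
  (* At a deepest vertex t of a cycle, both cyclic neighbours must be the parent of t, so two steps
     along the cycle return to t. *)
  have up s : s \in c -> tree_edge p s t -> s = p t.
    move=> sc; rewrite /tree_edge /= => /andP[st /orP[/eqP ps|/eqP//]].
    have sr : s != r by apply: contraNneq st => sr; rewrite -ps sr pr.
    have := hp s sr; rewrite ps ltnNge; case/negP; exact: maxt.
  have Ep : prev c t = p t by apply: up; rewrite ?mem_prev //; exact: (prev_cycle cyc tc).
  have En : next c t = p t.
    by apply: up; rewrite ?mem_next //; rewrite tree_edge_sym; exact: (next_cycle cyc tc).
  have /rot_to[i c' Ec] := tc.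
  have Ur : uniq (rot i c) by rewrite rot_uniq.
  have tt : next (rot i c) (next (rot i c) t) = t.
    by rewrite !next_rot // En -Ep next_prev.
  have sz : 2 < size (rot i c) by rewrite size_rot.
  move: tt Ur sz; rewrite Ec; case: c' {Ec} => [|x [|y c']] //=.
  rewrite eqxx; case: eqVneq => [->|tx]; first by rewrite inE eqxx.
  by rewrite eqxx => ->; rewrite !inE eqxx orbT.
Qed.

Lemma decomposes_tree_decomposition (G : sgraph) (good : {set G} -> Prop)
    (D : rooted_bags G) :
  decomposes good setT D ->
  tree_decomposition (T := parent_graph (@parent G D)) (fun t => bag t).
Proof.
case=> pr hp _ _ _ De Dt; split; first exact: parent_graph_tree pr hp.
- move=> v; have [|t /andP[vt _]] := De v v (in_setT v); first by rewrite eqxx.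
  by exists t.
- by move=> u v uv; apply: De; rewrite ?uv ?orbT ?inE.
- move=> v s t vs vt; have [t0 top0] := Dt v.
  set e := induced_edge _.
  have to_t0 (x : node D) : v \in bag x -> connect e x t0.
    have [n] := ubnP (depth x); elim: n x => // n IH x ltn_x vx.
    have [->|xt] := eqVneq x t0; first exact: connect0.
    have /andP[xr vp] := top0 x vx xt.
    have lt_p := hp x xr.
    apply: connect_trans (connect1 _) (IH (parent x) _ vp); last by lia.
    rewrite /e /induced_edge /= /tree_edge /= !inE vx vp eqxx /= andbT.
    by apply/eqP => xp; rewrite -xp ltnn in lt_p.
  apply: connect_trans (to_t0 s vs) _.
  rewrite (@induced_connect_sym (parent_graph (@parent G D)) [set x | v \in bag x]).
  exact: to_t0.
Qed.

(** * Real-valued distances, separators and logarithms *)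

Local Open Scope ring_scope.

Lemma gball_walk (R : realType) (G : sgraph) (d : nat) (u v : G) :
  v \in gball u (d%:R : R) -> walk d u v.
Proof.
rewrite inE => le_d; apply: contrapT => no_walk.
suff : (d.+1%:R%:E <= d%:R%:E :> \bar R)%E by rewrite lee_fin ler_nat ltnn.
apply: le_trans le_d; apply/ereal_infP => _ [p [pp lp] <-].
rewrite lee_fin ler_nat ltnNge; apply/negP => sp.
by apply: no_walk; exists p.
Qed.

Lemma walk_gball (R : realType) (G : sgraph) (d : nat) (rho : R) (u v : G) :
  d%:R <= rho -> walk d u v -> v \in gball u rho.
Proof.
move=> le_d [p [pp lp] sp]; rewrite inE; apply: ge_ereal_inf.
exists (size p)%:R%:E; first by exists p.
by rewrite lee_fin (le_trans _ le_d) // ler_nat.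
Qed.

Lemma separator_number_separable (R : realType) (G : sgraph) (r k : nat) :
  (separator_number R G r <= k)%N -> separable R G r k.
Proof.
rewrite /separator_number; case: ex_minnP => k0 /asboolP sep_k0 _ le_k mu mu_ge0.
have [X [S cardS covX] balX] := sep_k0 mu mu_ge0.
by exists X => //; exists S => //; apply: le_trans cardS _; rewrite ler_nat.
Qed.

(** The weight function is the indicator of S. *)
Lemma separable_set (R : realType) (G : sgraph) (r k : nat) (S : {set G}) :
  separable R G r k -> exists X Y : {set G},
    [/\ (#|Y| <= k)%N, covers r Y (fun=> 1%N) X
      & forall D, D \in components_del X -> (2 * #|S :&: D| <= #|S|)%N].
Proof.
move=> sep; have [|X [Y cardY covX] balX] := sep (fun v => (v \in S)%:R).
  by move=> v; exact: ler0n.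
exists X, Y; split; first by rewrite ler_nat in cardY.
- move=> v /(subsetP covX)/bigcupP[u uY uv]; exists u => //.
  by rewrite mul1n; exact: gball_walk uv.
- move=> D /balX.
  have card_sum (A : {set G}) : \sum_(v in A) (v \in S)%:R = #|S :&: A|%:R :> R.
    rewrite -sum1_card natr_sum [RHS]big_mkcond [LHS]big_mkcond.
    by apply: eq_bigr => v _; rewrite inE; case: (v \in A); case: (v \in S).
  have -> : \sum_(v : G) (v \in S)%:R = #|S|%:R :> R.
    by rewrite -[S in RHS]setIT -card_sum; apply: eq_bigl => v; rewrite inE.
  by rewrite card_sum ler_pdivlMl // -natrM ler_nat.
Qed.

Lemma separable_set2 (R : realType) (G : sgraph) (r k : nat) (S S' : {set G}) :
  separable R G r k -> exists X Y : {set G},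
    [/\ (#|Y| <= 2 * k)%N, covers r Y (fun=> 1%N) X
      & forall D, D \in components_del X ->
          (2 * #|S :&: D| <= #|S|)%N /\ (2 * #|S' :&: D| <= #|S'|)%N].
Proof.
move=> sep; have [X [Y [cardY covX balX]]] := separable_set S sep.
have [X' [Y' [cardY' covX' balX']]] := separable_set S' sep.
exists (X :|: X'), (Y :|: Y'); split.
- by apply: leq_trans (leq_card_setU _ _) _; rewrite mul2n -addnn leq_add.
- by move=> v /setUP[/covX|/covX'] [u uY uv]; exists u => //; rewrite inE uY ?orbT.
- have half (Z A D E : {set G}) :
      (2 * #|A :&: E| <= #|A|)%N -> D \subset E -> (2 * #|A :&: D| <= #|A|)%N.
    by move=> leE DE; apply: leq_trans leE; rewrite leq_mul2l subset_leq_card ?setIS.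
  move=> D DX; split.
    by have [E /balX leE DE] := components_del_mono (subsetUl X X') DX; exact: half leE DE.
  by have [E /balX' leE DE] := components_del_mono (subsetUr X X') DX; exact: half leE DE.
Qed.

Lemma ln2_gt0 (R : realType) : 0 < ln (2 : R).
Proof. by apply: ln_gt0; rewrite ltr1n. Qed.

Lemma ler_log2 (R : realType) (x y : R) : 0 < x -> x <= y -> log2 x <= log2 y.
Proof.
move=> x_gt0 xy; rewrite ler_pM2r ?invr_gt0 ?ln2_gt0 //.
by rewrite ler_ln ?posrE // (lt_le_trans x_gt0).
Qed.

Lemma log2M (R : realType) (x y : R) :
  0 < x -> 0 < y -> log2 (x * y) = log2 x + log2 y.
Proof. by move=> x_gt0 y_gt0; rewrite /log2 lnM ?posrE // mulrDl. Qed.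

Lemma log2X (R : realType) (n : nat) : log2 (2 ^+ n : R) = n%:R.
Proof. by rewrite /log2 lnXn // -[ln 2 *+ n]mulr_natl mulfK // gt_eqF ?ln2_gt0. Qed.

Lemma log2_ge1 (R : realType) (k : nat) : (2 <= k)%N -> 1 <= log2 (k%:R : R).
Proof.
move=> k2; rewrite -[leLHS](@log2X R 1) expr1.
by rewrite ler_log2 ?ltr0n ?ler_nat.
Qed.

(** * The invariant of the recursion and its constants *)

Theorem theorem1p4 :
  exists c : nat,
    forall (R : realType) (r k n : nat) (G : sgraph),
      (0 < r)%N -> (2 <= k)%N -> (2 <= n)%N -> #|G| = n ->
      (separator_number R G r <= k)%N ->
      exists (T : sgraph) (B : T -> {set G}),
        tree_decomposition B /\
        forall t : T,
          coverable (c%:R * k%:R ^+ 2 * log2 (k%:R : R))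
            (r%:R * (log2 k%:R + log2 (log2 n%:R) + c%:R)) (B t).
Proof.
exists 262%N => R r k n G r_gt0 k2 n2 cardG /separator_number_separable sep.
have logk := @log2_ge1 R k k2; have logn := @log2_ge1 R n n2.
have loglogn : 0 <= log2 (log2 (n%:R : R)).
  by rewrite -[leLHS](@log2X R 0) expr0 ler_log2.
set rho := r%:R * _; pose m := (2 * k)%N.
pose good := coverable (262%:R * k%:R ^+ 2 * log2 (k%:R : R)) rho : {set G} -> Prop.
(* Here d is the recursion depth, which the last bound limits to log n while C is nonempty. *)
pose inv (C : {set G}) := exists d (S : {set G}) (a : G -> nat),
  [/\ covers r S a (nbhd C), (#|S| <= 64 * m * m + 2 * m)%N,
      (\sum_(u in S) 2 ^ a u <= 2 * m * d)%N & (#|C| * 2 ^ d <= n)%N].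
have good0 : good set0.
  exists set0; last by rewrite sub0set.
  rewrite cards0; apply: mulr_ge0; last exact: le_trans ler01 logk.
  by rewrite mulr_ge0 ?exprn_ge0 ?ler0n.
have step (C : {set G}) : inv C -> C != set0 -> exists X : {set G},
    good (nbhd C :|: (C :&: X)) /\ forall D, D \in components_del X ->
      inv (C :&: D) /\ (#|C :&: D| < #|C|)%N.
  move=> [d [S [a [covS cardS sumS cardC]]]] C0.
  have C_gt0 : (0 < #|C|)%N by rewrite card_gt0.
  have [X [Y [cardY covX balX]]] := separable_set2 S C sep.
  exists X; split; last first.
    move=> D DX; have [balS balC] := balX D DX; split; last by lia.
    have m_gt0 : (0 < m)%N by rewrite /m; lia.
    have [S' [a' [covS' cardS' sumS']]] :=
      covers_component r_gt0 m_gt0 cardY DX covS covX.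
    exists d.+1, S', a'; split.
    - move=> v /(subsetP (nbhd_component C DX)) v_in; apply: covS'.
      by move: v_in; rewrite !inE => /orP[->|/andP[->]]; rewrite ?orbT.
    (* Half of 64m^2 + 2m, plus 32m^2 + m, is 64m^2 + 2m again. *)
    - by lia.
    - by lia.
    - by rewrite expnS; nia.
  have le_d : d%:R <= log2 (n%:R : R).
    rewrite -[leLHS]log2X ler_log2 ?exprn_gt0 // -natrX ler_nat.
    by apply: leq_trans cardC; rewrite leq_pmull.
  have le_a u : u \in S -> (a u)%:R <= log2 k%:R + log2 (log2 n%:R) + 2 :> R.
    (* A single term is at most the whole potential 2md = 4kd. *)
    move=> uS; have le_2a : (2 ^ a u <= 2 ^ 2 * k * d)%N.
      apply: leq_trans (leq_trans _ sumS) _; last by rewrite /m; lia.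
      by rewrite (bigD1 u) //= leq_addr.
    have k_gt0 : 0 < k%:R :> R by rewrite ltr0n; lia.
    have n_gt0 : 0 < log2 (n%:R : R) by exact: lt_le_trans logn.
    rewrite -[X in _ <= _ + X](@log2X R 2) -!log2M ?exprn_gt0 ?(mulr_gt0 k_gt0 n_gt0) //.
    rewrite -[leLHS]log2X.
    rewrite ler_log2 ?exprn_gt0 // -natrX.
    apply: (@le_trans _ _ (2 ^ 2 * k * d)%:R); first by rewrite ler_nat.
    rewrite [leRHS]mulrC mulrA -natrX -natrM [in leLHS]natrM ler_pM2l ?ltr0n //.
    by lia.
  exists (S :|: Y).
    (* With m = 2k, S and Y together have at most 256k^2 + 6k <= 262k^2 centres, and log k >= 1. *)
    apply: (@le_trans _ _ (262%:R * k%:R ^+ 2)); last first.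
      by rewrite ler_peMr // mulr_ge0 ?exprn_ge0 ?ler0n.
    rewrite -natrX -natrM ler_nat; apply: leq_trans (leq_card_setU _ _) _.
    apply: leq_trans (leq_add cardS cardY) _; rewrite /m; nia.
  have le_rho (j : nat) : j%:R <= log2 k%:R + log2 (log2 n%:R) + 262%:R :> R ->
      (j * r)%:R <= rho.
    by move=> le_j; rewrite natrM mulrC ler_pM2l ?ltr0n.
  apply/subsetP => v /setUP[/covS[u uS wuv]|/setIP[_ /covX[u uY wuv]]];
    apply/bigcupP; exists u; try by rewrite inE ?uS ?uY ?orbT.
    apply: walk_gball wuv; apply: le_rho.
    by apply: le_trans (le_a u uS) _; rewrite lerD2l ler_nat.
  apply: walk_gball wuv; apply: le_rho.
  by apply: (@le_trans _ _ 262%:R); rewrite ?ler_nat // lerDr addr_ge0 // (le_trans ler01).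
have invT : inv setT.
  exists 0%N, set0, (fun=> 0%N); split; rewrite ?cards0 ?big_set0 //.
    by move=> v; rewrite !inE.
  by rewrite cardsT cardG muln1.
have [D decD] := exists_decomposes good0 step invT.
exists (parent_graph (@parent G D)), (fun t => bag t); split.
  exact: decomposes_tree_decomposition decD.
exact: decomposes_good decD.
Qed.
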